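(* Let $\Gamma$ be a group, let $B$ be a subset of $\Gamma$, let $H_L,H_R$ be subgroups of $\Gamma$, let $\Gamma=H_LBH_R$ be a bi-gyrodecomposition, and let $(B,\oplus)$ be the corresponding bi-gyrogroup. Then $B$ equipped with the bi-gyrogroup operation $\oplus$ forms a gyrogroup.
   Context: Bi-transversal: a subset $B$ of a group $\Gamma$ is a bi-transversal of subgroups $H_L,H_R$ if every $g\in\Gamma$ can be written uniquely as $g=h_\ell b h_r$ with $h_\ell\in H_L$, $b\in B$, $h_r\in H_R$. Then for $b_1,b_2\in B$ there are unique $h_\ell(b_1,b_2)\in H_L$, $b_1\oplus_b b_2\in B$, $h_r(b_1,b_2)\in H_R$ with $b_1b_2 = h_\ell(b_1,b_2)(b_1\oplus_b b_2)h_r(b_1,b_2)$; $\oplus_b$ is the bi-transversal operation. The left and right gyrations are the maps $\mathrm{lgyr}[b_1,b_2]b = h_r(b_1,b_2)\,b\,h_r(b_1,b_2)^{-1}$ and $\mathrm{rgyr}[b_1,b_2]b = h_\ell(b_1,b_2)^{-1}\,b\,h_\ell(b_1,b_2)$ for $b\in B$. Bi-gyrotransversal: a bi-transversal $B$ of $H_L,H_R$ such that $hBh^{-1}\subseteq B$ for all $h\in H_L$ and all $h\in H_R$, and $h_\ell h_r=h_rh_\ell$ for all $h_\ell\in H_L,h_r\in H_R$. Twisted subgroup: a subset $B$ of $\Gamma$ with $1\in B$; $b\in B\Rightarrow b^{-1}\in B$; and $a,b\in B\Rightarrow aba\in B$. Bi-gyrodecomposition: a decomposition $\Gamma=H_LBH_R$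 such that $B$ is a bi-gyrotransversal of $H_L$ and $H_R$ in $\Gamma$, $B$ is a twisted subgroup of $\Gamma$, and $h_\ell(a,b)^{-1}=h_\ell(b,a)$, $h_r(a,b)^{-1}=h_r(b,a)$ for all $a,b\in B$. Bi-gyrogroup: for a bi-gyrodecomposition, the bi-gyrogroup operation on $B$ is $a\oplus b=\mathrm{rgyr}[b,a](a\oplus_b b)$, and $(B,\oplus)$ is called the (corresponding) bi-gyrogroup. Gyrogroup: a set $G$ with binary operation $\oplus$ such that (G1) there is $0\in G$ with $0\oplus a=a$ for all $a\in G$; (G2) for each $a\in G$ there is $b\in G$ with $b\oplus a=0$; (G3) for all $a,b\in G$ there is an automorphism $\mathrm{gyr}[a,b]\in\mathrm{Aut}(G,\oplus)$ with $a\oplus(b\oplus c)=(a\oplus b)\oplus\mathrm{gyr}[a,b]c$ for all $c\in G$; (G4) $\mathrm{gyr}[a,b]=\mathrm{gyr}[a\oplus b,b]$ for all $a,b\in G$. *)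

(* Defs.v *)
From HB Require Import structures.
From mathcomp Require Import all_boot.
From mathcomp Require Import boolp classical_sets.
Set Implicit Arguments.
Unset Strict Implicit.
Unset Printing Implicit Defensive.
Local Open Scope group_scope.

Section BiTransversal.
Variables (Gamma : groupType) (HL B HR : set Gamma).

(* The triple ((hl, b), hr) witnesses g = hl * b * hr. *)
Definition factorization (g : Gamma) (t : Gamma * Gamma * Gamma) : Prop :=
  [/\ t.1.1 \in HL, t.1.2 \in B, t.2 \in HR & g = t.1.1 * t.1.2 * t.2].

Definition bitransversal : Prop :=
  forall g : Gamma, exists! t : Gamma * Gamma * Gamma, factorization g t.

(* The factorization of g; it has the junk value (1, 1, 1) when g has none,
   which cannot happen for a bi-transversal. *)
Definition factor (g : Gamma) : Gamma * Gamma * Gamma :=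
  xget (1, 1, 1) [set t | factorization g t].

Definition hl (b1 b2 : Gamma) : Gamma := (factor (b1 * b2)).1.1.
Definition bitrans_op (b1 b2 : Gamma) : Gamma := (factor (b1 * b2)).1.2.
Definition hr (b1 b2 : Gamma) : Gamma := (factor (b1 * b2)).2.

Definition rgyr (b1 b2 b : Gamma) : Gamma := (hl b1 b2)^-1 * b * hl b1 b2.

Definition bigyrotransversal : Prop :=
  [/\ bitransversal,
      forall h b, h \in HL -> b \in B -> h * b * h^-1 \in B,
      forall h b, h \in HR -> b \in B -> h * b * h^-1 \in B &
      forall h1 h2, h1 \in HL -> h2 \in HR -> h1 * h2 = h2 * h1].

Definition twisted_subgroup : Prop :=
  [/\ 1 \in B,
      forall b, b \in B -> b^-1 \in B &
      forall a b, a \in B -> b \in B -> a * b * a \in B].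

(* The equation Gamma = HL B HR is part of bitransversal. *)
Definition bigyrodecomposition : Prop :=
  [/\ bigyrotransversal,
      twisted_subgroup,
      forall a b, a \in B -> b \in B -> (hl a b)^-1 = hl b a &
      forall a b, a \in B -> b \in B -> (hr a b)^-1 = hr b a].

Lemma factorP (g : Gamma) : bitransversal -> factorization g (factor g).
Proof.
move=> /(_ g)[t [gt _]].
exact: (@xgetPex _ (1, 1, 1) [set t | factorization g t]
          (ex_intro _ t gt)).
Qed.

Lemma bigyro_op_subproof (a b : Gamma) :
  group_closed [in HL] -> bigyrodecomposition -> rgyr b a (bitrans_op a b) \in B.
Proof.
move=> /group_closedV HLV [[trB normL _ _] _ _ _].
have [_ abB _ _] := factorP (a * b) trB.
have [hHL _ _ _] := factorP (b * a) trB.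
by have := normL _ _ (HLV _ hHL) abB; rewrite invgK.
Qed.

(* The bi-gyrogroup operation, on the subtype {x : Gamma | x \in B}. *)
Definition bigyro_op (gHL : group_closed [in HL]) (D : bigyrodecomposition)
    (a b : set_type B) : set_type B :=
  exist _ (rgyr (val b) (val a) (bitrans_op (val a) (val b)))
        (bigyro_op_subproof (val a) (val b) gHL D).

End BiTransversal.

Definition is_automorphism (G : Type) (op : G -> G -> G) (f : G -> G) : Prop :=
  bijective f /\ forall x y, f (op x y) = op (f x) (f y).

Definition is_gyrogroup (G : Type) (op : G -> G -> G) : Prop :=
  (exists zero : G,
      (forall a, op zero a = a) /\
      (forall a, exists b, op b a = zero)) /\
  (exists gyr : G -> G -> G -> G,
      [/\ forall a b, is_automorphism op (gyr a b),
          forall a b c, op a (op b c) = op (op a b) (gyr a b c) &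
          forall a b, gyr a b = gyr (op a b) b]).

(* Main.v *)
Require Import Defs.
From mathcomp Require Import all_boot.
From mathcomp Require Import boolp classical_sets.

(** Since [HL] and [HR] commute elementwise and both normalize [B], the product
    [K = HL HR] is a subgroup normalizing [B], and moving the left factor of
    [l * b * r] across [b] turns the two-sided factorization of [Gamma] into a
    one-sided one: [B] is a transversal of [K].  The twist by [rgyr b a] in the
    bi-gyrogroup operation performs exactly this move on the product of [a] and
    [b]: as [hl b a = (hl a b)^-1], the element [rgyr b a (bitrans_op a b)] is
    the [B]-component of [a * b] in [Gamma = B K], and its [K]-component is
    [h a b = hl a b * hr a b].  So the bi-gyrogroup is the groupoid of a
    gyrotransversal that is a twisted subgroup with [h b a = (h a b)^-1].

    For such a transversal ([gyrotransversal_gyrogroup]), the gyration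
    [gyr a b] is conjugation by [h a b].  Conjugation by an element of [K]
    preserves both [B] and [K], hence the factorization of a product, hence the
    operation.  Comparing the [B]-components of [a * (b * c)] and
    [(a * b) * c] gives the gyroassociative law.  The loop property comes from
    the twisted subgroup axiom: [b * a * b] lies in [B], so its [K]-component
    [h b (a + b) * h a b] (with [+] for the operation) is trivial, and then
    [h (a + b) b = (h b (a + b))^-1 = h a b]. *)

Local Open Scope group_scope.
Local Open Scope classical_set_scope.

Section Gyrotransversal.
Variables (Gamma : groupType) (B K : set Gamma).
Hypothesis gK : group_closed [in K].
Hypothesis nBK : forall k b, k \in K -> b \in B -> b ^ k \in B.
Hypothesis uniqBK : forall b1 b2 k1 k2, b1 \in B -> b2 \in B ->
  k1 \in K -> k2 \in K -> b1 * k1 = b2 * k2 -> b1 = b2 /\ k1 = k2.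
Hypothesis twB : twisted_subgroup B.
Variables (op : B -> B -> B) (h : B -> B -> Gamma).
Hypothesis hK : forall a b, h a b \in K.
Hypothesis opE : forall a b, val a * val b = val (op a b) * h a b.
Hypothesis hV : forall a b, (h a b)^-1 = h b a.

Lemma transversal_opP (a b : B) c k : c \in B -> k \in K ->
  val a * val b = c * k -> val (op a b) = c /\ h a b = k.
Proof. by move=> cB kK; rewrite opE; exact: uniqBK (valP _) cB (hK a b) kK. Qed.

Definition conj_in k (kK : k \in K) (c : B) : B :=
  exist _ (val c ^ k) (nBK k (val c) kK (valP c)).

(** Conjugation by an element of [K] maps the factorization of [a * b] to that
    of the product of the conjugates. *)
Lemma conj_in_aut k (kK : k \in K) : is_automorphism op (conj_in k kK).
Proof.
split=> [|a b].
- exists (conj_in k^-1 (group_closedV gK kK)) => c; apply: val_inj => /=.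
    by rewrite conjgK.
  by rewrite conjgKV.
- have kkK : h a b ^ k \in K.
    by rewrite /conjg !(group_closedM gK, group_closedV gK).
  apply: val_inj; symmetry.
  have [|//] := transversal_opP (conj_in k kK a) (conj_in k kK b)
    _ _ (valP (conj_in k kK (op a b))) kkK.
  by rewrite /= -!conjMg opE.
Qed.

(** The inverse accounts for [x ^ k] being [k^-1 * x * k], whereas the gyration
    is [c] mapped to [h a b * c * (h a b)^-1]. *)
Definition trans_gyr (a b : B) : B -> B :=
  conj_in (h a b)^-1 (group_closedV gK (hK a b)).

(** Moving [h a b] across [c] conjugates [c] by it, so both bracketings of
    [a * b * c] factor through [B K] with the [B]-components compared here. *)
Lemma trans_gyr_assoc (a b c : B) :
  op a (op b c) = op (op a b) (trans_gyr a b c).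
Proof.
have hd : h a b * val c = val (trans_gyr a b c) * h a b.
  by rewrite /= /conjg invgK !mulgA mulgVK.
set d := trans_gyr a b c in hd *.
have kK : h (op a b) d * h a b * (h b c)^-1 \in K.
  by rewrite !(group_closedM gK, group_closedV gK, hK).
apply: val_inj.
have [|//] := transversal_opP a (op b c) _ _ (valP (op (op a b) d)) kK.
apply: (mulIg (h b c)); rewrite -mulgA -opE !mulgA mulgVK -opE.
by rewrite -[RHS]mulgA -hd mulgA opE.
Qed.

Lemma twisted_loop (a b : B) : h (op a b) b = h a b.
Proof.
case: twB => _ _ Btw; rewrite -hV.
have kK : (h a b)^-1 \in K := group_closedV gK (hK a b).
(* The product [b * (a * b)] is [op b (op a b) * (h b (op a b) * h a b)], and its
   [K]-component is [1] because it lies in [B]. *)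
have [|_ ->] := transversal_opP b (op a b) _ _ (Btw _ _ (valP b) (valP a)) kK.
  by apply: (mulIg (h a b)); rewrite mulgVK -mulgA -opE mulgA.
by rewrite invgK.
Qed.

(** The left inverse of [a] for [op] is its inverse in [Gamma], which
    belongs to [B] because [B] is a twisted subgroup. *)
Theorem gyrotransversal_gyrogroup : is_gyrogroup op.
Proof.
have [B1 BV _] := twB; have K1 := gK.1; split.
  pose e : B := exist _ 1 B1.
  exists e; split=> a.
    apply: val_inj; have [|//] := transversal_opP e a _ _ (valP a) K1.
    by rewrite mul1g mulg1.
  pose a' : B := exist _ (val a)^-1 (BV _ (valP a)).
  exists a'; apply: val_inj; have [|//] := transversal_opP a' a _ _ B1 K1.
  by rewrite mulVg mulg1.
exists trans_gyr; split=> [a b|a b c|a b].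
- exact: conj_in_aut.
- exact: trans_gyr_assoc.
- by apply/funext => c; apply: val_inj; rewrite /= twisted_loop.
Qed.

End Gyrotransversal.

Section OneSided.
Variables (Gamma : groupType) (HL B HR : set Gamma).
Hypothesis gHL : group_closed [in HL].
Hypothesis gHR : group_closed [in HR].

Definition prod_subgroup : set Gamma :=
  [set k | exists l r, [/\ l \in HL, r \in HR & k = l * r]].

Lemma prod_subgroupP k :
  reflect (exists l r, [/\ l \in HL, r \in HR & k = l * r])
          (k \in prod_subgroup).
Proof. by apply: (iffP idP); rewrite in_setE. Qed.

Hypothesis bgtB : bigyrotransversal HL B HR.

Lemma prod_subgroup_closed : group_closed [in prod_subgroup].
Proof.
case: bgtB => _ _ _ comm; split.
  by apply/prod_subgroupP; exists 1, 1; rewrite mulg1 gHL.1 gHR.1.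
move=> _ _ /prod_subgroupP[l [r [lL rR ->]]] /prod_subgroupP[m [s [mL sR ->]]].
apply/prod_subgroupP; exists (l / m), (r / s); split.
- exact: gHL.2.
- exact: gHR.2.
have rsR : r / s \in HR by apply: gHR.2.
have mL' : m^-1 \in HL by apply: group_closedV.
by rewrite invgM -!mulgA (comm _ _ mL' rsR) !mulgA.
Qed.

Lemma prod_subgroup_normalizes k b :
  k \in prod_subgroup -> b \in B -> b ^ k \in B.
Proof.
case: bgtB => _ nL nR _ /prod_subgroupP[l [r [lL rR ->]]] bB.
have nLJ x : x \in B -> x ^ l \in B.
  by move=> xB; have := nL _ _ (group_closedV gHL lL) xB; rewrite invgK -mulgA.
have nRJ x : x \in B -> x ^ r \in B.
  by move=> xB; have := nR _ _ (group_closedV gHR rR) xB; rewrite invgK -mulgA.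
by rewrite conjgM nRJ ?nLJ.
Qed.

(** Writing [b * (l * r)] as [l * b ^ l * r] makes it a two-sided
    factorization. *)
Lemma prod_subgroup_uniq b1 b2 k1 k2 : b1 \in B -> b2 \in B ->
  k1 \in prod_subgroup -> k2 \in prod_subgroup ->
  b1 * k1 = b2 * k2 -> b1 = b2 /\ k1 = k2.
Proof.
move=> b1B b2B k1K k2K e.
case: bgtB => trB nL _ _.
have fact b k : b \in B -> k \in prod_subgroup ->
    exists l r, k = l * r /\ factorization HL B HR (b * k) (l, b ^ l, r).
  move=> bB /prod_subgroupP[l [r [lL rR ->]]]; exists l, r; split=> //.
  split=> //=; last by rewrite /conjg mulVKg mulgA.
  by have := nL _ _ (group_closedV gHL lL) bB; rewrite invgK -mulgA.
have [l1 [r1 [k1E f1]]] := fact _ _ b1B k1K.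
have [l2 [r2 [k2E f2]]] := fact _ _ b2B k2K.
rewrite -e in f2; have [t [_ ut]] := trB (b1 * k1).
have := ut _ f2; rewrite (ut _ f1) => -[el eb er].
by move: eb; rewrite k1E k2E el er => /conjg_inj.
Qed.

End OneSided.

Theorem theorem4p28 (Gamma : groupType) (HL B HR : set Gamma)
  (gHL : group_closed [in HL]) (gHR : group_closed [in HR])
  (D : bigyrodecomposition HL B HR) :
  is_gyrogroup (bigyro_op gHL D).
Proof.
have [bgt twB hlV hrV] := D; have [trB _ _ comm] := bgt.
apply: (@gyrotransversal_gyrogroup _ _ (prod_subgroup _ HL HR)
  _ _ _ twB _ (fun a b =>
    hl HL B HR (val a) (val b) * hr HL B HR (val a) (val b))).
- exact: prod_subgroup_closed bgt.
- exact: prod_subgroup_normalizes bgt.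
- exact: prod_subgroup_uniq bgt.
- move=> a b; have [lL _ rR _] := factorP (val a * val b) trB.
  by apply/prod_subgroupP; do 2 eexists; split; [exact: lL|exact: rR|].
- move=> a b; have [_ _ _ abE] := factorP (val a * val b) trB.
  by rewrite /= /rgyr -(hlV _ _ (valP a) (valP b)) invgK !mulgA mulgVK.
- move=> a b; have [lL _ rR _] := factorP (val b * val a) trB.
  rewrite invgM (hlV _ _ (valP a) (valP b)) (hrV _ _ (valP a) (valP b)).
  exact: esym (comm _ _ lL rR).
Qed.
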